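(* Let $n\ge1$, and let rows $i$ and $j$ both be horizontal strip rows, with spectral parameters $x_i$ and $x_j$. Then the rectangular vertex weights of horizontal strip rows together with the $HH$ weights of $R^{(n)}$-vertices satisfy the Yang–Baxter equation: for all boundary labels $a,\alpha\in\{\wedge,\vee\}$ and $b,c,\beta,\gamma\in\{<,>\}^n$, $$\sum_{\boldsymbol I,\boldsymbol J,\delta}\operatorname{wt}\!\big(R(\boldsymbol I,\boldsymbol J,c,b)\big)\,\operatorname{wt}_{i}\!\big(a,\delta;\boldsymbol I,\gamma\big)\,\operatorname{wt}_{j}\!\big(\delta,\alpha;\boldsymbol J,\beta\big)=\sum_{\boldsymbol K,\boldsymbol L,\xi}\operatorname{wt}_{j}\!\big(a,\xi;b,\boldsymbol L\big)\,\operatorname{wt}_{i}\!\big(\xi,\alpha;c,\boldsymbol K\big)\,\operatorname{wt}\!\big(R(\gamma,\beta,\boldsymbol K,\boldsymbol L)\big),$$ where the sums run over $\boldsymbol I,\boldsymbol J,\boldsymbol K,\boldsymbol L\in\{<,>\}^n$ and $\delta,\xi\in\{\wedge,\vee\}$.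
   Context: **Rectangular vertices.** An $n$-ribbon vertex $v$ has labels $v_N,v_S\in\{\wedge,\vee\}$ (arrows up/down) on the vertical edges above and below it, and $n$-tuples $v_W,v_E\in\{<,>\}^n$ (arrows left/right) on its left and right sides, with components $v_W(k),v_E(k)$, $1\le k\le n$, where $k=1$ is the bottom strand and $k=n$ the top strand. It is admissible if the number of arrows pointing in equals the number pointing out and $v_E(k)=v_W(k+1)$ for $1\le k\le n-1$. An admissible vertex has one of six types, given by $(v_N,v_S,v_W(1),v_E(n))$: SW: $(\wedge,\wedge,>,>)$; NS: $(\vee,\wedge,<,>)$; SE: $(\wedge,\wedge,<,<)$; NW: $(\vee,\vee,>,>)$; EW: $(\wedge,\vee,>,<)$; NE: $(\vee,\vee,<,<)$. Let $s$ be the number of left arrows among $v_E(1),\dots,v_E(n-1)$. In a horizontal strip row with spectral parameter $x$ the weights are: SW: $q^s$; NS: $q^s$; SE: $0$; NW: $1$; EW: $q^sx$; NE: $q^sx$. Non-admissible vertices have weight $0$. For tuples $P,Q\in\{<,>\}^n$ listed from top to bottom, $\operatorname{wt}_i(N,S;P,Q)$ denotes the weight in row $i$ of the vertex with $v_N=N$, $v_S=S$, $v_W(n+1-k)=P_k$, $v_E(n+1-k)=Q_k$ for $1\le k\le n$; similarly $\operatorname{wt}_j$ for row $j$. **$R^{(n)}$-vertices.** An $R^{(n)}$-vertex $R(\boldsymbol I,\boldsymbol J,\boldsymbol K,\boldsymbol L)$ is a diagonal vertex with label tuples in $\{<,>\}^n$, each listed from top to bottom: $\boldsymbol I$ (upper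 right), $\boldsymbol J$ (lower right), $\boldsymbol K$ (lower left), $\boldsymbol L$ (upper left). The row-$i$ strand joins $\boldsymbol K$ to $\boldsymbol I$ and the row-$j$ strand joins $\boldsymbol L$ to $\boldsymbol J$. It is viewed as $n$ stacked $R^{(1)}$-vertices $r_k=(I_k,J_k,K_k,L_k)$, $1\le k\le n$ ($k=1$ on top), and its weight is $\prod_{k=1}^n\operatorname{wt}(r_k)$. The types of $R^{(1)}$-vertices, given by $(I_k,J_k,K_k,L_k)$, are: N: $(>,<,>,<)$; SS: $(>,<,<,>)$; W: $(<,<,<,<)$; E: $(>,>,>,>)$; NN: $(<,>,>,<)$; S: $(<,>,<,>)$. Any other $R^{(1)}$-vertex has weight $0$. For fixed $k$ let $$\theta=2\,\#\{t>k:r_t=\mathrm S\},\qquad\sigma=\#\{t>k:r_t=\mathrm{SS}\}+\#\{t<k:r_t=\mathrm{NN}\}+\#\{t:r_t=\mathrm W\}.$$ The $HH$ weights are: N: $0$; SS: $x_j$; W: $x_j$; E: $x_i$; NN: $x_i$; S: $\dfrac{q^{\theta}x_i-x_j}{q^{\theta+\sigma}}$. *)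

(* Defs.v *)
From HB Require Import structures.
From mathcomp Require Import all_boot all_order all_algebra.

Set Implicit Arguments.
Unset Strict Implicit.
Unset Printing Implicit Defensive.

Import GRing.Theory.
Local Open Scope ring_scope.

Inductive varrow := Up | Down.

Inductive harrow := Left | Right.

Definition varrow_to_bool (a : varrow) : bool := if a is Up then true else false.
Definition bool_to_varrow (b : bool) : varrow := if b then Up else Down.
Lemma varrow_to_boolK : cancel varrow_to_bool bool_to_varrow.
Proof. by case. Qed.
HB.instance Definition _ := Finite.copy varrow (can_type varrow_to_boolK).

Definition harrow_to_bool (a : harrow) : bool := if a is Right then true else false.
Definition bool_to_harrow (b : bool) : harrow := if b then Right else Left.
Lemma harrow_to_boolK : cancel harrow_to_bool bool_to_harrow.
Proof. by case. Qed.
HB.instance Definition _ := Finite.copy harrow (can_type harrow_to_boolK).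

Definition labels (n : nat) := {ffun 'I_n -> harrow}.

(* Reverses the order of the strands: bottom-to-top <-> top-to-bottom. *)
Definition flip (n : nat) (P : labels n) : labels n := [ffun k => P (rev_ord k)].

(* The ribbon width is n.+1.  In this section W and E are the left and right
   labels listed from bottom to top and indexed from 0, so that ord0 is the
   bottom strand and ord_max the top strand. *)
Section RectangularVertex.

Variables (F : fieldType) (n : nat).
Implicit Types (N S : varrow) (W E : labels n.+1).

(* Down on the top edge, Up on the bottom edge, Right on the left side and Left
   on the right side point towards the vertex. *)
Definition num_in N S W E : nat :=
  ((N == Down) + (S == Up) + #|[pred k | W k == Right]| + #|[pred k | E k == Left]|)%N.

Definition num_out N S W E : nat :=
  ((N == Up) + (S == Down) + #|[pred k | W k == Left]| + #|[pred k | E k == Right]|)%N.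

Definition admissible N S W E : bool :=
  (num_in N S W E == num_out N S W E) &&
  [forall k : 'I_n.+1, forall l : 'I_n.+1, (l == k.+1 :> nat) ==> (E k == W l)].

(* Left arrows on the right side, the top strand excluded. *)
Definition num_left E : nat := #|[pred k : 'I_n.+1 | (k < n)%N && (E k == Left)]|.

Definition vertex_wt (q x : F) N S W E : F :=
  if admissible N S W E then
    match N, S, W ord0, E ord_max with
    | Up,   Up,   Right, Right => q ^+ num_left E      (* SW *)
    | Down, Up,   Left,  Right => q ^+ num_left E      (* NS *)
    | Up,   Up,   Left,  Left  => 0                    (* SE *)
    | Down, Down, Right, Right => 1                    (* NW *)
    | Up,   Down, Right, Left  => q ^+ num_left E * x  (* EW *)
    | Down, Down, Left,  Left  => q ^+ num_left E * x  (* NE *)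
    | _, _, _, _ => 0
    end
  else 0.

(* Here P and Q are listed from top to bottom. *)
Definition row_wt (q x : F) N S (P Q : labels n.+1) : F :=
  vertex_wt q x N S (flip P) (flip Q).

End RectangularVertex.

(* Labels (upper right, lower right, lower left, upper left). *)
Definition r1vertex : Type := (harrow * harrow * harrow * harrow)%type.

Definition rN  : r1vertex := (Right, Left,  Right, Left).
Definition rSS : r1vertex := (Right, Left,  Left,  Right).
Definition rW  : r1vertex := (Left,  Left,  Left,  Left).
Definition rE  : r1vertex := (Right, Right, Right, Right).
Definition rNN : r1vertex := (Left,  Right, Right, Left).
Definition rS  : r1vertex := (Left,  Right, Left,  Right).

(* Strands are indexed from top to bottom, so t > k means that t is below k. *)
Section RVertex.

Variables (F : fieldType) (n : nat).
Implicit Types (r : 'I_n -> r1vertex) (k : 'I_n).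

Definition theta r k : nat := (2 * #|[pred t : 'I_n | (k < t)%N && (r t == rS)]|)%N.

Definition sigma r k : nat :=
  (#|[pred t : 'I_n | (k < t)%N && (r t == rSS)]|
   + #|[pred t : 'I_n | (t < k)%N && (r t == rNN)]|
   + #|[pred t : 'I_n | r t == rW]|)%N.

Definition HH_wt1 (q xi xj : F) r k : F :=
  if r k == rN then 0
  else if r k == rSS then xj
  else if r k == rW then xj
  else if r k == rE then xi
  else if r k == rNN then xi
  else if r k == rS then
    (q ^+ theta r k * xi - xj) / q ^+ (theta r k + sigma r k)
  else 0.

Definition HH_wt (q xi xj : F) (I J K L : labels n) : F :=
  \prod_(k < n) HH_wt1 q xi xj (fun t => (I t, J t, K t, L t)) k.

End RVertex.

(* Main.v *)
Require Import Defs.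
From HB Require Import structures.
From mathcomp Require Import all_boot all_order all_algebra.
From mathcomp Require Import ring zify.

Set Implicit Arguments.
Unset Strict Implicit.
Unset Printing Implicit Defensive.

Import GRing.Theory.
Local Open Scope ring_scope.

(** An admissible rectangular vertex shifts its tuple of horizontal labels by one
    strand: read from top to bottom, the right tuple [Q] is the left tuple [P]
    with its last (bottom) label removed and a new label put in front.  Apart
    from the factor [q ^+ s], where [s] counts the left arrows among the labels
    that are merely shifted, the vertex is an ordinary six-vertex interaction
    between the vertical line, the label that leaves at the bottom of [P] and
    the label that enters at the top of [Q] ([row_wtE]).

    Hence on the left-hand side all labels of [I] and [J] but the bottom ones
    are dictated by [gamma] and [beta], and on the right-hand side all labels of
    [K] and [L] but the top ones are dictated by [c] and [b].  Both sides
    therefore contain the same stack [m] of [n] R-vertices, whose entries are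
    (gamma_(k+1), beta_(k+1), c_k, b_k).  The left-hand side puts one more
    R-vertex below [m], the right-hand side puts one more on top of it.

    Although the weight of an S vertex depends on everything around it, the
    weight of a stack is multiplied, when a vertex is added at either end, by a
    factor that only depends on how many vertices of each type the stack
    contains.  On top this is immediate from the weights ([HH_wt1_top],
    [prod_HH_wt1]).  Below it amounts to the fact that adding one vertex above
    and one below are commuting operations ([top_bottom_factor],
    [stack_wt_rcons]).

    Cancelling the weight of [m] leaves an identity between two sums of eight
    terms, in which only the numbers of S, SS, NN and W vertices of [m] appear.
    The arrow counts in the exponents of the rectangular weights are themselves
    sums of these numbers, unless [m] contains a vertex of weight zero, in which
    case both sides vanish ([count_left_live], [stack_wt_live]).  What is left is
    one rational identity for each of the 64 choices of the two vertical and
    the four extreme horizontal boundary labels, namely [local_ybe]. *)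

(** * Sums over arrows, counting, and splitting off an end strand *)

Lemma sum_harrow (V : nmodType) (f : harrow -> V) :
  \sum_(h : harrow) f h = f Left + f Right.
Proof.
rewrite (bigD1 Left) //= (bigD1 Right) //= big1 ?addr0 //.
by case=> /andP[].
Qed.

Lemma sum_varrow (V : nmodType) (f : varrow -> V) :
  \sum_(v : varrow) f v = f Up + f Down.
Proof.
rewrite (bigD1 Up) //= (bigD1 Down) //= big1 ?addr0 //.
by case=> /andP[].
Qed.

Lemma card_codom (I : finType) (T : Type) (f : I -> T) (P : pred T) :
  #|[pred t | P (f t)]| = count P (codom f).
Proof. by rewrite count_map cardE -size_filter enumT. Qed.

Lemma card_ordSl n (P : pred 'I_n.+1) :
  #|[pred t | P t]| = (P ord0 + #|[pred t : 'I_n | P (lift ord0 t)]|)%N.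
Proof.
by rewrite -!sum1_card big_mkcond big_ord_recl -big_mkcond /= inE; case: (P _).
Qed.

Lemma card_ordSr n (P : pred 'I_n.+1) :
  #|[pred t | P t]|
  = (#|[pred t : 'I_n | P (widen_ord (leqnSn n) t)]| + P ord_max)%N.
Proof.
by rewrite -!sum1_card big_mkcond big_ord_recr -big_mkcond /= inE; case: (P _).
Qed.

Lemma codom_ordSl (T : Type) n (f : 'I_n.+1 -> T) :
  codom f = f ord0 :: codom (fun k : 'I_n => f (lift ord0 k)).
Proof. by rewrite /codom /image_mem enum_ordSl /= -map_comp. Qed.

Lemma codom_ordSr (T : Type) n (f : 'I_n.+1 -> T) :
  codom f = rcons (codom (fun k : 'I_n => f (widen_ord (leqnSn n) k))) (f ord_max).
Proof. by rewrite /codom /image_mem enum_ordSr map_rcons -map_comp. Qed.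

(** * Label tuples with one strand removed or added *)

Section Labels.
Variable n : nat.
Implicit Types (P : labels n.+1) (t : labels n).

Definition init (P : labels n.+1) : labels n :=
  [ffun k => P (widen_ord (leqnSn n) k)].
Definition tail (P : labels n.+1) : labels n := [ffun k => P (lift ord0 k)].
Definition snoc (t : labels n) h : labels n.+1 :=
  [ffun k => if unlift ord_max k is Some k' then t k' else h].
Definition lcons h (t : labels n) : labels n.+1 :=
  [ffun k => if unlift ord0 k is Some k' then t k' else h].

Lemma widen_lift (k : 'I_n) : widen_ord (leqnSn n) k = lift ord_max k.
Proof. by apply: val_inj; rewrite /= /bump leqNgt ltn_ord. Qed.

Lemma snoc_max t h : snoc t h ord_max = h.
Proof. by rewrite ffunE unlift_none. Qed.
Lemma snoc_widen t h k : snoc t h (widen_ord (leqnSn n) k) = t k.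
Proof. by rewrite ffunE widen_lift liftK. Qed.
Lemma lcons0 h t : lcons h t ord0 = h.
Proof. by rewrite ffunE unlift_none. Qed.
Lemma lcons_lift h t k : lcons h t (lift ord0 k) = t k.
Proof. by rewrite ffunE liftK. Qed.

Lemma init_snoc t h : init (snoc t h) = t.
Proof. by apply/ffunP=> k; rewrite ffunE snoc_widen. Qed.
Lemma tail_lcons h t : tail (lcons h t) = t.
Proof. by apply/ffunP=> k; rewrite ffunE lcons_lift. Qed.

Lemma snocE P : P = snoc (init P) (P ord_max).
Proof.
apply/ffunP=> k; rewrite [RHS]ffunE; case: unliftP => [j ->|-> //].
by rewrite ffunE widen_lift.
Qed.
Lemma lconsE P : P = lcons (P ord0) (tail P).
Proof.
apply/ffunP=> k; rewrite [RHS]ffunE; case: unliftP => [j ->|-> //].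
by rewrite ffunE.
Qed.

(** How a sum over tuples collapses to a sum over the bottom label, for a summand
    that forces all the other labels. *)
Lemma sum_init (V : nmodType) (G : labels n.+1 -> V) t :
  (forall P, init P != t -> G P = 0) ->
  \sum_P G P = \sum_(h : harrow) G (snoc t h).
Proof.
move=> G0; rewrite (partition_big (fun P : labels n.+1 => P ord_max) xpredT) //=.
apply: eq_bigr => h _; rewrite (bigD1 (snoc t h)) ?snoc_max //=.
rewrite big1 ?addr0 // => P /andP[/eqP Ph neP]; apply: G0.
by apply: contraNneq neP => <-; rewrite -Ph -snocE.
Qed.

Lemma sum_tail (V : nmodType) (G : labels n.+1 -> V) t :
  (forall P, tail P != t -> G P = 0) ->
  \sum_P G P = \sum_(h : harrow) G (lcons h t).
Proof.
move=> G0; rewrite (partition_big (fun P : labels n.+1 => P ord0) xpredT) //=.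
apply: eq_bigr => h _; rewrite (bigD1 (lcons h t)) ?lcons0 //=.
rewrite big1 ?addr0 // => P /andP[/eqP Ph neP]; apply: G0.
by apply: contraNneq neP => <-; rewrite -Ph -lconsE.
Qed.

End Labels.

(** * Rectangular vertices as one-strand vertices *)

Section Row.
Variables (F : fieldType) (q x : F).

(** [z] stands for the factor [q ^+ s] contributed by the shifted strands; [w] is
    the label entering on the left at the bottom and [e] the one leaving on the
    right at the top. *)
Definition strand_wt (z : F) N S (w e : harrow) : F :=
  match N, S, w, e with
  | Up,   Up,   Right, Right => z
  | Down, Up,   Left,  Right => z
  | Down, Down, Right, Right => 1
  | Up,   Down, Right, Left  => z * x
  | Down, Down, Left,  Left  => z * x
  | _, _, _, _ => 0
  end.

(** The shifted strands contribute as many arrows pointing in as pointing out, so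
    that the balance of arrows is decided by the two vertical labels and the two
    extreme horizontal ones.  All six types are balanced, which is why no balance
    condition remains. *)
Lemma row_wtE n N S (P Q : labels n.+1) :
  row_wt q x N S P Q =
  if tail Q == init P
  then strand_wt (q ^+ count_mem Left (codom (init P))) N S (P ord_max) (Q ord0)
  else 0.
Proof.
have flip_card R (h : harrow) :
    #|[pred k | flip R k == h]| = #|[pred k : 'I_n.+1 | R k == h]|.
  rewrite -!sum1_card (reindex_inj rev_ord_inj) /=.
  by apply: eq_bigl => k; rewrite !inE ffunE rev_ordK.
rewrite /row_wt /vertex_wt /admissible.
have -> : [forall k : 'I_n.+1, forall l : 'I_n.+1,
   (l == k.+1 :> nat) ==> (flip Q k == flip P l)] = (tail Q == init P).
  apply/idP/eqP => [/forallP H|H].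
    apply/ffunP=> k; rewrite !ffunE.
    have /forallP/(_ (rev_ord (widen_ord (leqnSn n) k))) :=
      H (rev_ord (lift ord0 k)).
    rewrite !ffunE !rev_ordK => /implyP/(_ _)/eqP-> //=.
    by rewrite /bump /=; have := ltn_ord k; lia.
  apply/forallP=> k; apply/forallP=> l; apply/implyP => /eqP lk.
  have ltk : (n - l < n)%N by have := ltn_ord l; lia.
  have /ffunP/(_ (Ordinal ltk)) := H; rewrite !ffunE.
  have -> : lift ord0 (Ordinal ltk) = rev_ord k.
    by apply: val_inj; rewrite /= /bump /=; have := ltn_ord l; lia.
  have -> : widen_ord (leqnSn n) (Ordinal ltk) = rev_ord l.
    by apply: val_inj; rewrite /=; lia.
  by move->.
case: (tail Q =P init P) => [H|_]; last by rewrite andbF.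
rewrite andbT.
have -> : flip P ord0 = P ord_max.
  by rewrite ffunE; congr (P _); apply: val_inj; rewrite /= subn1.
have -> : flip Q ord_max = Q ord0.
  by rewrite ffunE; congr (Q _); apply: val_inj; rewrite /= subnn.
have -> : num_left (flip Q) = count_mem Left (codom (init P)).
  rewrite /num_left (card_ordSr (fun k : 'I_n.+1 => (k < n)%N && (flip Q k == Left))).
  rewrite /= ltnn addn0 -H -card_codom.
  rewrite -!sum1_card (reindex_inj rev_ord_inj) /=.
  apply: eq_bigl => k; rewrite !inE !ffunE /=.
  have -> /= : (n - k.+1 < n)%N by have := ltn_ord k; lia.
  congr (Q _ == _); apply: val_inj; rewrite /= /bump /=.
  by have := ltn_ord k; lia.
rewrite /num_in /num_out !flip_card.
have cardP h : #|[pred k | P k == h]|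
    = (count_mem h (codom (init P)) + (P ord_max == h))%N.
  rewrite (card_ordSr (fun k => P k == h)) -card_codom; congr (_ + _)%N.
  by apply: eq_card => k; rewrite !inE ffunE.
have cardQ h : #|[pred k | Q k == h]|
    = ((Q ord0 == h) + count_mem h (codom (init P)))%N.
  rewrite (card_ordSl (fun k => Q k == h)) -H -card_codom; congr (_ + _)%N.
  by apply: eq_card => k; rewrite !inE ffunE.
rewrite !cardP !cardQ.
move: (count_mem Left _) (count_mem Right _) => A B.
case: N; case: S; case: (P ord_max); case: (Q ord0);
  rewrite /strand_wt ?if_same // !eqE /=; case: eqnP => //; lia.
Qed.

End Row.

(** * The weight of a stack of R-vertices *)

Section Stack.
Variables (F : fieldType) (q xi xj : F).
Hypothesis q0 : q != 0.

Implicit Types (r : r1vertex) (s : seq r1vertex).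

(** The factor by which the weight of the stack [s] changes when [r] is put on top
    of it: the weight of [r] itself, times q^-1 for each S vertex of [s] when [r]
    is of type NN or W, since these two types raise sigma for the vertices
    below. *)
Definition top_factor r s : F :=
  match r with
  | (Right, Left, Left, Right) => xj
  | (Left, Left, Left, Left) => xj / q ^+ count_mem rS s
  | (Right, Right, Right, Right) => xi
  | (Left, Right, Right, Left) => xi / q ^+ count_mem rS s
  | (Left, Right, Left, Right) =>
      (q ^+ (2 * count_mem rS s) * xi - xj)
      / q ^+ (2 * count_mem rS s + (count_mem rSS s + count_mem rW s))
  | _ => 0
  end.

(** The analogous factor for putting [r] below [s].  The value for S comes from
    the fact that the numerators in a stack with N vertices of type S are
    q^(2t) x_i - x_j for t = 0, 1, ..., N - 1, from bottom to top: an extra S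
    below moves each of them one step up, so that the product gains the factor
    with t = N whichever end the vertex is added to. *)
Definition bottom_factor s r : F :=
  match r with
  | (Right, Left, Left, Right) => xj / q ^+ count_mem rS s
  | (Left, Left, Left, Left) => xj / q ^+ count_mem rS s
  | (Right, Right, Right, Right) => xi
  | (Left, Right, Right, Left) => xi
  | (Left, Right, Left, Right) =>
      (q ^+ (2 * count_mem rS s) * xi - xj)
      / q ^+ (2 * count_mem rS s + (count_mem rNN s + count_mem rW s))
  | _ => 0
  end.

Fixpoint stack_wt s : F :=
  if s is r :: s' then top_factor r s' * stack_wt s' else 1.

(** Adding [t] on top and [r] below in either order gives the same weight; this
    compatibility is what makes [bottom_factor] correct for long stacks. *)
Lemma top_bottom_factor t s r :
  top_factor t (rcons s r) * bottom_factor s r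
  = top_factor t s * bottom_factor (t :: s) r.
Proof.
have qn k : q ^+ k != 0 by rewrite expf_neq0.
case: t => [[[[] []] []] []]; rewrite ?mul0r //;
case: r => [[[[] []] []] []]; rewrite ?mulr0 //;
  rewrite /= -?cats1 ?count_cat /= ?eqE /= ?(addn0, addn1, add0n, add1n);
  rewrite ?mulnS ?exprD ?exprS ?[q^+1]expr1 ?addn0; field; rewrite ?qn ?q0 //.
Qed.

Lemma stack_wt_rcons s r :
  stack_wt (rcons s r) = stack_wt s * bottom_factor s r.
Proof.
elim: s => [|t s IH] /=.
  rewrite mulr1 mul1r; case: r => [[[[] []] []] []] //=;
  by rewrite ?muln0 ?expr0 ?divr1.
by rewrite IH mulrCA top_bottom_factor mulrCA !mulrA.
Qed.

(** Strands above a given one do not enter theta, and enter sigma only through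
    types NN and W. *)
Lemma HH_wt1_lift n (r : 'I_n.+1 -> r1vertex) (k : 'I_n) :
  HH_wt1 q xi xj r (lift ord0 k) =
  HH_wt1 q xi xj (fun t => r (lift ord0 t)) k
  * (if r (lift ord0 k) == rS
     then (q ^+ ((r ord0 == rNN) + (r ord0 == rW)))^-1 else 1).
Proof.
have thetaE : theta r (lift ord0 k) = theta (fun t => r (lift ord0 t)) k.
  by rewrite /theta (card_ordSl (fun t => (lift ord0 k < t)%N && (r t == rS))).
have sigmaE : sigma r (lift ord0 k) =
    (sigma (fun t => r (lift ord0 t)) k
     + ((r ord0 == rNN) + (r ord0 == rW)))%N.
  rewrite /sigma (card_ordSl (fun t => (lift ord0 k < t)%N && (r t == rSS))).
  rewrite (card_ordSl (fun t => (t < lift ord0 k)%N && (r t == rNN))).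
  rewrite (card_ordSl (fun t => r t == rW)) /=.
  have regroup x y z d e :
      (0 + x + (d + y) + (e + z) = x + y + z + (d + e))%N by lia.
  exact: regroup.
rewrite /HH_wt1 thetaE sigmaE; case: (r (lift ord0 k)) => [[[[] []] []] []];
  rewrite ?eqE /= ?eqE /= ?mulr1 //.
by rewrite addnA [in LHS]exprD invfM mulrA.
Qed.

(** The power of q on the left collects the corrections of [HH_wt1_lift] over all
    S vertices below the top one. *)
Lemma HH_wt1_top n (r : 'I_n.+1 -> r1vertex) :
  HH_wt1 q xi xj r ord0
  * (q ^+ ((r ord0 == rNN) + (r ord0 == rW)))^-1
    ^+ count_mem rS (codom (fun t => r (lift ord0 t)))
  = top_factor (r ord0) (codom (fun t => r (lift ord0 t))).
Proof.
have qn k : q ^+ k != 0 by rewrite expf_neq0.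
have thetaE : theta r ord0
    = (2 * count_mem rS (codom (fun t => r (lift ord0 t))))%N.
  rewrite /theta (card_ordSl (fun t => (ord0 < t)%N && (r t == rS))) /=.
  by rewrite -card_codom.
have sigmaE : sigma r ord0 =
    (count_mem rSS (codom (fun t => r (lift ord0 t)))
     + count_mem rW (codom (fun t => r (lift ord0 t))) + (r ord0 == rW))%N.
  rewrite /sigma (card_ordSl (fun t => (ord0 < t)%N && (r t == rSS))) /=.
  rewrite (card_ordSl (fun t => r t == rW)) -!card_codom.
  rewrite [X in (_ + X + _)%N]eq_card0 //.
  by rewrite add0n addn0 addnCA addnC.
rewrite /HH_wt1 thetaE sigmaE.
case: (r ord0) => [[[[] []] []] []]; rewrite ?eqE /= ?eqE /=;
  by rewrite ?(invr1, expr0, expr1n, mul0r, mulr1, expr1, exprVn, addn0).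
Qed.

Lemma prod_HH_wt1 n (r : 'I_n -> r1vertex) :
  \prod_(k < n) HH_wt1 q xi xj r k = stack_wt (codom r).
Proof.
elim: n r => [|n IH] r.
  by rewrite big_ord0 (size0nil (s := codom r)) // size_codom card_ord.
rewrite big_ord_recl codom_ordSl /= -IH -HH_wt1_top.
under eq_bigr => k _ do rewrite HH_wt1_lift.
rewrite big_split /= -[X in _ * (_ * X)]big_mkcond prodr_const.
by rewrite -card_codom mulrCA mulrC.
Qed.

End Stack.

(** * The local Yang-Baxter equation *)

(** The types whose weight is not identically zero; N is excluded. *)
Definition live (r : r1vertex) : bool :=
  [|| r == rSS, r == rW, r == rE, r == rNN | r == rS].

Lemma stack_wt_live (F : fieldType) (q xi xj : F) s :
  ~~ all live s -> stack_wt q xi xj s = 0.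
Proof.
elim: s => //= r s IH; rewrite negb_and => /orP[|/IH->]; last by rewrite mulr0.
by case: r => [[[[] []] []] []] //= _; rewrite mul0r.
Qed.

(** Type N is what has to be absent here: it has left arrows on its lower right
    and upper left sides but leaves no trace in the weights of the others. *)
Lemma count_left_live (s : seq r1vertex) : all live s ->
  [/\ count (fun r => r.1.1.1 == Left) s
      = (count_mem rW s + count_mem rNN s + count_mem rS s)%N,
      count (fun r => r.1.1.2 == Left) s = (count_mem rW s + count_mem rSS s)%N,
      count (fun r => r.1.2 == Left) s
      = (count_mem rW s + count_mem rSS s + count_mem rS s)%N
    & count (fun r => r.2 == Left) s = (count_mem rW s + count_mem rNN s)%N].
Proof.
elim: s => //= r s IH /andP[lr /IH[-> -> -> ->]].
by case: r lr => [[[[] []] []] []] //= _; rewrite ?eqE /= ?eqE /=; split; lia.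
Qed.

Section Local.
Variables (F : fieldType) (q xi xj : F).
Hypothesis q0 : q != 0.

(** The two sides differ only through powers of q whose exponents are linear in
    the numbers of vertices of each type in [s], so that after [count_left_live]
    each choice of boundary labels is an identity of rational functions in
    [xi], [xj] and these powers. *)
Lemma local_ybe s (a alpha : varrow) (b c beta gamma : harrow) :
  all live s ->
  let left p := q ^+ count p s in
  \sum_(i : harrow) \sum_(j : harrow) \sum_(d : varrow)
     bottom_factor q xi xj s (i, j, c, b)
     * strand_wt xi (left (fun r => r.1.1.1 == Left)) a d i gamma
     * strand_wt xj (left (fun r => r.1.1.2 == Left)) d alpha j beta
  = \sum_(k : harrow) \sum_(l : harrow) \sum_(e : varrow)
     strand_wt xj (left (fun r => r.2 == Left)) a e b l
     * strand_wt xi (left (fun r => r.1.2 == Left)) e alpha c k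
     * top_factor q xi xj (gamma, beta, k, l) s.
Proof.
move=> /count_left_live[e1 e2 e3 e4] left; rewrite /left e1 e2 e3 e4.
have qn k : q ^+ k != 0 by rewrite expf_neq0.
rewrite !sum_harrow !sum_varrow {left e1 e2 e3 e4}.
case: a; case: alpha; case: b; case: c; case: beta; case: gamma;
  rewrite /= ?(mul0r, mulr0, add0r, addr0) //;
  rewrite ?[(2 * _)%N]mulnC ?exprD ?exprM; field; rewrite ?qn //.
Qed.
End Local.

(** * Reduction of the ribbon equation to the local one *)

Lemma HH_wt_snoc (F : fieldType) n (q xi xj : F) (hq : q != 0)
    (s t : labels n) (i j : harrow) (c b : labels n.+1) :
  let m := codom (fun k => (s k, t k, init c k, init b k)) in
  HH_wt q xi xj (snoc s i) (snoc t j) c b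
  = stack_wt q xi xj m * bottom_factor q xi xj m (i, j, c ord_max, b ord_max).
Proof.
move=> m; rewrite /HH_wt prod_HH_wt1 // codom_ordSr stack_wt_rcons //.
rewrite !snoc_max (eq_codom (g := fun k => (s k, t k, init c k, init b k))) //.
by move=> k; rewrite !snoc_widen !ffunE.
Qed.

Lemma HH_wt_lcons (F : fieldType) n (q xi xj : F) (hq : q != 0)
    (s t : labels n) (k l : harrow) (gamma beta : labels n.+1) :
  let m := codom (fun k => (tail gamma k, tail beta k, s k, t k)) in
  HH_wt q xi xj gamma beta (lcons k s) (lcons l t)
  = top_factor q xi xj (gamma ord0, beta ord0, k, l) m * stack_wt q xi xj m.
Proof.
move=> m; rewrite /HH_wt prod_HH_wt1 // codom_ordSl /= !lcons0.
rewrite (eq_codom (g := fun k => (tail gamma k, tail beta k, s k, t k))) //.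
by move=> u; rewrite !lcons_lift !ffunE.
Qed.

Theorem theorem5p1 (F : fieldType) (n : nat) (q xi xj : F) (hq : q != 0)
    (a alpha : varrow) (b c beta gamma : labels n.+1) :
  \sum_(I : labels n.+1) \sum_(J : labels n.+1) \sum_(delta : varrow)
     HH_wt q xi xj I J c b
     * row_wt q xi a delta I gamma
     * row_wt q xj delta alpha J beta
  = \sum_(K : labels n.+1) \sum_(L : labels n.+1) \sum_(eps : varrow)
     row_wt q xj a eps b L
     * row_wt q xi eps alpha c K
     * HH_wt q xi xj gamma beta K L.
Proof.
pose m := codom (fun k => (tail gamma k, tail beta k, init c k, init b k)).
(* Reads the exponents of the four rectangular weights off the stack [m]. *)
have countE (T : Type) (f : 'I_n -> T) (g : T -> harrow) (t : labels n) :
    t =1 g \o f ->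
    count_mem Left (codom t) = count (fun r => g r == Left) (codom f).
  by move=> tE; rewrite (eq_codom tE) !count_map; apply: eq_count.
have eI : count_mem Left (codom (tail gamma))
    = count (fun r => r.1.1.1 == Left) m by exact: countE.
have eJ : count_mem Left (codom (tail beta))
    = count (fun r => r.1.1.2 == Left) m by exact: countE.
have eK : count_mem Left (codom (init c))
    = count (fun r => r.1.2 == Left) m by exact: countE.
have eL : count_mem Left (codom (init b))
    = count (fun r => r.2 == Left) m by exact: countE.
transitivity (stack_wt q xi xj m * \sum_(i : harrow) \sum_(j : harrow)
     \sum_(d : varrow)
     bottom_factor q xi xj m (i, j, c ord_max, b ord_max)
     * strand_wt xi (q ^+ count (fun r => r.1.1.1 == Left) m) a d i (gamma ord0)
     * strand_wt xj (q ^+ count (fun r => r.1.1.2 == Left) m)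
         d alpha j (beta ord0)).
  rewrite (sum_init (t := tail gamma)) => [|I neI]; last first.
    rewrite big1 // => J _; rewrite big1 // => d _.
    by rewrite row_wtE eq_sym (negPf neI) mulr0 mul0r.
  rewrite mulr_sumr; apply: eq_bigr => i _.
  rewrite (sum_init (t := tail beta)) => [|J neJ]; last first.
    by rewrite big1 // => d _; rewrite [X in _ * X]row_wtE eq_sym (negPf neJ) mulr0.
  rewrite mulr_sumr; apply: eq_bigr => j _.
  rewrite mulr_sumr; apply: eq_bigr => d _.
  by rewrite HH_wt_snoc // !row_wtE !init_snoc !eqxx !snoc_max eI eJ !mulrA.
transitivity (stack_wt q xi xj m * \sum_(k : harrow) \sum_(l : harrow)
     \sum_(e : varrow)
     strand_wt xj (q ^+ count (fun r => r.2 == Left) m) a e (b ord_max) l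
     * strand_wt xi (q ^+ count (fun r => r.1.2 == Left) m)
         e alpha (c ord_max) k
     * top_factor q xi xj (gamma ord0, beta ord0, k, l) m); last first.
  rewrite (sum_tail (t := init c)) => [|K neK]; last first.
    rewrite big1 // => L _; rewrite big1 // => e _.
    by rewrite [X in _ * X * _]row_wtE (negPf neK) mulr0 mul0r.
  rewrite mulr_sumr; apply: eq_bigr => k _.
  rewrite (sum_tail (t := init b)) => [|L neL]; last first.
    by rewrite big1 // => e _; rewrite row_wtE (negPf neL) !mul0r.
  rewrite mulr_sumr; apply: eq_bigr => l _.
  rewrite mulr_sumr; apply: eq_bigr => e _.
  rewrite HH_wt_lcons // !row_wtE !tail_lcons !eqxx !lcons0 eK eL.
  by rewrite mulrC -!mulrA.
have [live_m|/stack_wt_live->] := boolP (all live m); last by rewrite !mul0r.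
by congr (_ * _); exact: local_ybe.
Qed.
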